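(* Let $p$ be a prime, $n\ge 1$, and let $C\subseteq \mathbf{F}_p^{2n}$ be a linear space with $C\subseteq C^\perp$. (1) Let $I\subseteq\{1,\dots,n\}$, let $\vec{x}_1,\dots,\vec{x}_\ell\in C$, and let $D\subseteq C$ be the linear space they span. If a decoder for $Q(C)$ can correct erasures at $I$ by measuring the observables corresponding to $\vec{x}_1,\dots,\vec{x}_\ell$, then $C\cap\mathbf{F}_p^I=D^\perp\cap\mathbf{F}_p^I$. Therefore, the minimum number of measurements for correcting erasures at $I$ on codewords in $Q(C)$ is $$\min_{D\subseteq C}\{\dim D: C\cap\mathbf{F}_p^I=D^\perp\cap\mathbf{F}_p^I\}.$$ (2) For $0\le\delta\le n$, the minimum cardinality of a fixed set of observables (the same set being used for every erasure position set $I$ with $|I|=\delta$) for correcting any $\delta$ erasures on codewords in $Q(C)$ is $$\min_{D\subseteq C}\{\dim D: w_s(D^\perp\setminus C)\ge\delta+1\}=2n-\max_{D^\perp\supseteq C^\perp}\{\dim D^\perp: w_s(D^\perp\setminus C)\ge\delta+1\}.$$ Here, for every $D\subseteq C$, $w_s(D^\perp\setminus C)$ is greater than or equal to the minimum distance $w_s(D^\perp\setminus D)$ of the quantum stabilizer code $Q(D)$.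
   Context: $\mathbf{F}_p$ is the field with $p$ elements. Vectors of $\mathbf{F}_p^{2n}$ are written $(a_1,\dots,a_n|b_1,\dots,b_n)$. The symplectic inner product is $\langle (a|b),(a'|b')\rangle=\sum_{i=1}^n (a_ib'_i-a'_ib_i)$ and $C^\perp$ is the orthogonal space with respect to it. For $J\subseteq\{1,\dots,n\}$, $\mathbf{F}_p^J=\{(a|b)\in\mathbf{F}_p^{2n}: a_i=b_i=0 \text{ if } i\notin J\}$. For $\vec{x}=(a|b)$, $w_s(\vec{x})=|\{i: a_i\ne 0\text{ or }b_i\neq 0\}|$ is the symplectic weight, and for a set $T\subseteq \mathbf{F}_p^{2n}$, $w_s(T)=\min\{w_s(\vec{x}):\vec{x}\in T\}$, with $w_s(\emptyset)=+\infty$. Subspaces $D$ range over linear subspaces. If the set over which a minimum or maximum is taken is empty, the erasures in question cannot be corrected and the corresponding minimum number is undefined. Let $\mathcal{H}_p$ be a $p$-dimensional complex space with orthonormal basis $|0\rangle,\dots,|p-1\rangle$, $X|i\rangle=|i+1 \bmod p\rangle$, $Z|i\rangle=\exp(2\pi\sqrt{-1}/p)^i|i\rangle$, and $M(a|b)=X^{a_1}Z^{b_1}\otimes\cdots\otimes X^{a_n}Z^{b_n}$ acting on $\mathcal{H}_p^{\otimes n}$. For $C\subseteq C^\perp$, the group $S$ generated by $\{M(\vec{x}):\vec{x}\in C\}$ is commutative; fix a common eigenvector of $S$ and let $\eta(U)$ be its eigenvalue for $U\in S$ (not required to be $+1$). The stabilizer code is $Q(C)=\{|\psi\rangle\in\mathcal{H}_p^{\otimes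 n}: U|\psi\rangle=\eta(U)|\psi\rangle \text{ for all } U\in S\}$. Measurement and correction. For $\vec{x}\in C$, the observable corresponding to $\vec{x}$ is one whose eigenspaces are those of $M(\vec{x})$. For an erasure vector $\vec{e}\in\mathbf{F}_p^I$ and a codeword $|\psi\rangle\in Q(C)$, measuring it on $M(\vec{e})|\psi\rangle$ gives a deterministic outcome equivalent to the value $\langle\vec{x},\vec{e}\rangle\in\mathbf{F}_p$. Measuring the observables of $\vec{x}_1,\dots,\vec{x}_\ell\in C$ ($\ell$ measurements) gives the syndrome $s(\vec{e})=(\langle \vec{x}_i,\vec{e}\rangle)_{i=1}^{\ell}$. A decoder can correct erasures at $I$ on codewords in $Q(C)$ by these measurements if for each $s\in\mathbf{F}_p^\ell$ there is a unitary $U_s$ such that for all $\vec{e}\in\mathbf{F}_p^I$ with $s(\vec{e})=s$ and all $|\psi\rangle\in Q(C)$, the vector $U_sM(\vec{e})|\psi\rangle$ equals $|\psi\rangle$ up to a scalar phase; equivalently, $s(\vec{e})$ determines $\vec{e}\in\mathbf{F}_p^I$ uniquely modulo $C$. All measured observables are those corresponding to vectors of $C$. ''Correcting any $\delta$ erasures'' means correcting erasures at $I$ for every $I\subseteq\{1,\dots,n\}$ with $|I|=\delta$. *)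

(* Defs.v *)
From HB Require Import structures.
From mathcomp Require Import all_boot all_order all_algebra.
From mathcomp Require Import reals constructive_ereal trigo.
From mathcomp Require Import complex.

Set Implicit Arguments.
Unset Strict Implicit.
Unset Printing Implicit Defensive.

Import Order.TTheory GRing.Theory Num.Theory.
Local Open Scope ring_scope.

Section Symplectic.
Variables (p n : nat).

(* (a_1, ..., a_n | b_1, ..., b_n). Note that 'F_p is the field of p elements
   only for p prime, which the theorem assumes. *)
Definition svec := 'rV['F_p]_(n + n).

Definition apart (x : svec) (i : 'I_n) : 'F_p := x 0 (lshift n i).
Definition bpart (x : svec) (i : 'I_n) : 'F_p := x 0 (rshift n i).

Definition symp (x y : svec) : 'F_p :=
  \sum_(i < n) (apart x i * bpart y i - apart y i * bpart x i).

Fact symp_linear_l (y : svec) :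
  GRing.linear_for *%R (fun x => symp x y : 'F_p).
Proof.
move=> c u v; rewrite /symp mulr_sumr -big_split /=; apply: eq_bigr => i _.
by rewrite /apart /bpart !mxE mulrDl mulrDr mulrBr mulrCA !mulrA addrACA opprD.
Qed.

Fact symp_skew (x y : svec) : symp x y = (-1) ^+ true * idfun (symp y x).
Proof.
rewrite expr1 mulN1r /symp -sumrN; apply: eq_bigr => i _.
by rewrite opprB.
Qed.

Fact symp_linear_r (x : svec) :
  GRing.linear_for (idfun \; *%R) (symp x).
Proof.
move=> c u v; rewrite (symp_skew x (c *: u + v)) symp_linear_l.
by rewrite (symp_skew x u) (symp_skew x v) /= expr1 !mulN1r opprD mulrN.
Qed.

HB.instance Definition _ := bilinear_isBilinear.Build
  'F_p svec svec 'F_p *%R (idfun \; *%R) symp (symp_linear_l, symp_linear_r).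
HB.instance Definition _ := isHermitianSesquilinear.Build
  'F_p svec true idfun symp symp_skew.

Definition dual (C : {vspace svec}) : {vspace svec} := orthov symp C.

(* dual is C^perp *)
Fact dualP (C : {vspace svec}) (x : svec) :
  reflect (forall y, y \in C -> symp x y = 0) (x \in dual C).
Proof. exact: mem_orthovP. Qed.

Definition vset (C : {vspace svec}) : {set svec} := [set x in C].

(* F_p^J *)
Definition supported (J : {set 'I_n}) : {set svec} :=
  [set x | [forall i, (i \notin J) ==> (apart x i == 0) && (bpart x i == 0)]].

Definition sweight (x : svec) : nat :=
  #|[set i | (apart x i != 0) || (bpart x i != 0)]|.

(* w_s(T); the minimum over the empty set is +oo. *)
Definition sweight_min (T : {set svec}) : \bar int :=
  \big[mine/+oo%E]_(x in T) (sweight x)%:Z%:E.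

Definition min_distance (D : {vspace svec}) : \bar int :=
  sweight_min (vset (dual D) :\: vset D).

(* Measuring the observable of x in C (whose eigenspaces are those of M(x)) on
   M(e) psi, psi a codeword, has a deterministic outcome, which is equivalent to
   the value <x, e>; outcomes are therefore taken in 'F_p. *)
Definition syndrome (l : nat) (xs : l.-tuple svec) (e : svec) : l.-tuple 'F_p :=
  [tuple symp (tnth xs i) e | i < l].

End Symplectic.

Section Qudits.
Variables (R : realType) (p n : nat).

Local Notation svec := (svec p n).

(* exp(2 pi sqrt(-1) / p) *)
Definition omega : R[i] :=
  Complex (cos (2 * pi / p%:R)) (sin (2 * pi / p%:R)).

(* The column j of a matrix is the image of the basis vector |j>. *)
Definition shiftX : 'M[R[i]]_p := \matrix_(i, j) (i == ordS j)%:R.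
Definition clockZ : 'M[R[i]]_p := diag_mx (\row_i omega ^+ i).

(* H_p^{(x) n} is the space of column vectors of coordinates in the product
   basis |f_1> (x) ... (x) |f_n>, indexed by the functions f. *)
Definition hdim : nat := #|{: {ffun 'I_n -> 'I_p}}|.

Definition basis_label (k : 'I_hdim) : {ffun 'I_n -> 'I_p} := enum_val k.

Definition tensor (A : 'I_n -> 'M[R[i]]_p) : 'M[R[i]]_hdim :=
  \matrix_(k, l) \prod_(i < n) A i (basis_label k i) (basis_label l i).

(* M(a|b) *)
Definition pauli (x : svec) : 'M[R[i]]_hdim :=
  tensor (fun i => shiftX ^+ (apart x i : nat) *m clockZ ^+ (bpart x i : nat)).

(* The group S generated by the M(x), x in C. *)
Inductive stab_group (C : {vspace svec}) : 'M[R[i]]_hdim -> Prop :=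
| stab_gen x of x \in C : stab_group C (pauli x)
| stab_one : stab_group C 1%:M
| stab_mul U V of stab_group C U & stab_group C V : stab_group C (U *m V)
| stab_inv U of stab_group C U : stab_group C (invmx U).

(* phi is a common eigenvector of S, with eigenvalue eta U for U in S; the
   values of eta outside S are irrelevant. *)
Definition common_eigen (C : {vspace svec}) (phi : 'cV[R[i]]_hdim)
    (eta : 'M[R[i]]_hdim -> R[i]) : Prop :=
  phi != 0 /\ forall U, stab_group C U -> U *m phi = eta U *: phi.

Definition stab_code (C : {vspace svec}) (eta : 'M[R[i]]_hdim -> R[i])
    (psi : 'cV[R[i]]_hdim) : Prop :=
  forall U, stab_group C U -> U *m psi = eta U *: psi.

(* Erasures at I on the codewords of Q can be corrected by measuring the
   observables corresponding to the entries of xs: the decoder applies a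
   unitary that depends only on the measured syndrome. *)
Definition corrects (Q : 'cV[R[i]]_hdim -> Prop) (I : {set 'I_n})
    (l : nat) (xs : l.-tuple svec) : Prop :=
  forall s : l.-tuple 'F_p,
  exists2 U : 'M[R[i]]_hdim, U \is unitarymx &
    forall e, e \in supported p I -> syndrome xs e = s ->
    forall psi, Q psi ->
    exists2 c : R[i], `|c| = 1 & U *m (pauli e *m psi) = c *: psi.

End Qudits.

(* m is the minimum (maximum) of P; there is no such m when the minimum
   (maximum) is undefined. *)
Definition is_min (P : nat -> Prop) (m : nat) : Prop :=
  P m /\ forall k, P k -> (m <= k)%N.
Definition is_max (P : nat -> Prop) (m : nat) : Prop :=
  P m /\ forall k, P k -> (k <= m)%N.

(* Main.v *)
Require Import Defs.
From mathcomp Require Import all_boot all_order all_algebra.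
From mathcomp Require Import reals constructive_ereal complex.
From mathcomp Require Import trigo ring.

(* Measuring vectors that span D corrects the erasures at I iff every e in
   D^perp supported on I lies in C.  If it does not, e is not orthogonal to some
   f in C^perp; M(f) preserves Q(C) and commutes with M(e) up to a phase c <> 1,
   so for a codeword v the codewords v and M(f) v are eigenvectors of M(e) for
   different eigenvalues, and M(e) does not fix v + M(f) v up to a scalar,
   although e has the same syndrome as 0.  Conversely, undoing M(e0) for one e0
   with the observed syndrome leaves M(e - e0) with e - e0 in C, which acts on
   Q(C) by a phase.  Minimal families of observables are then bases of the
   spaces D. *)

Set Implicit Arguments.
Unset Strict Implicit.
Unset Printing Implicit Defensive.

Import Order.TTheory GRing.Theory Num.Theory.
Local Open Scope ring_scope.

(** * Linear algebra of the symplectic form: duals, syndromes, supports and weights *)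

Section SymplecticSpace.
Variables p n : nat.
Local Notation svec := (svec p n).
Implicit Types (x y e : svec) (C D U V : {vspace svec}) (I : {set 'I_n}).

Lemma symp_eq0C x y : (symp x y == 0) = (symp y x == 0).
Proof. exact: (herm_eq0C (@symp p n)). Qed.

Lemma sympDr x : {morph symp x : y z / y + z}.
Proof. exact: linearDr. Qed.

Lemma sympBr x : {morph symp x : y z / y - z}.
Proof. exact: linearBr. Qed.

Lemma sympZr x a y : symp x (a *: y) = a * symp x y.
Proof. exact: linearZr. Qed.

Lemma symp0r x : symp x 0 = 0.
Proof. exact: linear0r. Qed.

Lemma mem_dual D x : (x \in dual D) = [forall y in D, symp x y == 0].
Proof.
apply/dualP/forall_inP => [h y /h/eqP //|h y /h/eqP //].
Qed.

Lemma dual_sub_sym U V : (U <= dual V)%VS = (V <= dual U)%VS.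
Proof. exact: orthov_sym. Qed.

Lemma dualD U V : dual (U + V) = (dual U :&: dual V)%VS.
Proof.
apply/vspaceP => x; rewrite memv_cap; apply/dualP/andP => [xUV|[/dualP xU /dualP xV]].
  split; apply/dualP => y yU; apply: xUV; move: y yU; apply/subvP.
    exact: addvSl.
  exact: addvSr.
by move=> _ /memv_addP[u uU [v vV ->]]; rewrite sympDr xU // xV // addr0.
Qed.

Lemma dualS U V : (U <= V)%VS -> (dual V <= dual U)%VS.
Proof. by move=> UV; rewrite dual_sub_sym (subv_trans UV) // dual_sub_sym. Qed.

(** Nondegeneracy: pairing with a unit vector reads off one coordinate of [x]. Unit vectors of the
    a-half are negated to absorb the minus sign in the form. *)
Lemma dual_full : dual {:svec} = 0%VS.
Proof.
apply/vspaceP => x; rewrite memv0; apply/idP/eqP => [/dualP x0|->]; last first.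
  exact: mem0v.
apply/rowP => k; rewrite mxE -(splitK k).
have h i f : \sum_(j < n) (if j == i then f j else 0) = f i :> 'F_p.
  by rewrite -big_mkcond big_pred1_eq.
case: (split k) => i /=.
- have := x0 (delta_mx 0 (rshift n i)) (memvf _); rewrite /symp => <-.
  rewrite -[LHS](h i (fun j => x 0 (lshift n j))); apply: eq_bigr => j _.
  rewrite /apart /bpart !mxE eqxx /= eq_rshift eq_lrshift mul0r subr0.
  by case: eqP; rewrite ?mulr1 ?mulr0.
- have := x0 (- delta_mx 0 (lshift n i)) (memvf _); rewrite /symp => <-.
  rewrite -[LHS](h i (fun j => x 0 (rshift n j))); apply: eq_bigr => j _.
  rewrite /apart /bpart !mxE eqxx /= eq_lshift eq_rlshift oppr0 mulr0 sub0r.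
  by case: eqP; rewrite ?mulNr ?opprK ?mul1r ?mul0r ?oppr0.
Qed.

Lemma dim_svec : dim svec = (n + n)%N.
Proof. exact: mul1n. Qed.

Lemma leq_dim_cap_dual1 V x : ((\dim V).-1 <= \dim (V :&: dual <[x]>))%N.
Proof. exact: (@leq_dim_orthov1 _ _ _ _ _ _ _). Qed.

(** Each generator imposes one linear equation, which lowers the dimension by at most one. *)
Lemma dim_dual_span (s : seq svec) :
  (n + n <= \dim (dual <<s>>) + size s)%N.
Proof.
elim: s => [|x s IHs] /=.
  have -> : dual <<[::]>> = {:svec}%VS.
    apply/vspaceP => x; rewrite memvf; apply/dualP => y.
    by rewrite span_nil memv0 => /eqP ->; rewrite symp0r.
  by rewrite dimvf addn0 dim_svec.
rewrite span_cons addvC dualD addnS (leq_trans IHs) // -addSn leq_add2r.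
by case: (\dim (dual <<s>>)) (leq_dim_cap_dual1 (dual <<s>>) x).
Qed.

Lemma dim_dual D : (\dim (dual D) + \dim D = n + n)%N.
Proof.
have ge V : (n + n <= \dim (dual V) + \dim V)%N.
  by rewrite -{1}(span_basis (vbasisP V)) -{2}(size_tuple (vbasis V)) dim_dual_span.
apply/eqP; rewrite eqn_leq ge andbT.
have dimf : \dim {:svec} = (n + n)%N by rewrite dimvf dim_svec.
have capDC : (dual D :&: dual D^C = 0)%VS by rewrite -dualD addv_complf dual_full.
(* The duals of complementary spaces meet trivially, so the lower bound applied
   to D^C bounds the dimension of dual D from above. *)
have := dimvS (subvf (dual D + dual D^C)).
rewrite (dimv_disjoint_sum capDC) dimf => le1.
have := ge (D^C)%VS; rewrite dimv_compl dimf => le2.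
have := dimvS (subvf D); rewrite dimf => le3.
rewrite -(leq_add2r (\dim (dual D^C))) addnAC addnC.
apply: (@leq_trans (\dim D + (n + n))%N); first by rewrite leq_add2l.
by rewrite addnC leq_add2l -(leq_add2r (n + n - \dim D)) subnKC.
Qed.

Lemma dualK : involutive (@dual p n).
Proof.
move=> D; apply/eqP; rewrite eq_sym eqEdim dual_sub_sym subvv /=.
by rewrite -(leq_add2r (\dim (dual D))) dim_dual addnC dim_dual.
Qed.

Lemma syndrome0P l (xs : l.-tuple svec) e :
  reflect (syndrome xs e = [tuple 0 | _ < l]) (e \in dual <<xs>>).
Proof.
(* By symmetry of orthogonality the claim becomes that [<<xs>>] lies in the dual of the line of [e],
   which can be tested on the entries of [xs]. *)
rewrite memvE dual_sub_sym.
apply: (iffP span_subvP) => [exs|s0 _ /tnthP[i ->]].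
  apply: eq_from_tnth => i; rewrite !tnth_mktuple.
  exact: (dualP _ _ (exs _ (mem_tnth _ _)) _ (memv_line e)).
have := congr1 (fun t : l.-tuple _ => tnth t i) s0; rewrite !tnth_mktuple => xe0.
by apply/dualP => _ /vlineP[k ->]; rewrite sympZr xe0 mulr0.
Qed.

Lemma syndromeB l (xs : l.-tuple svec) e e' :
  syndrome xs e = syndrome xs e' -> e - e' \in dual <<xs>>.
Proof.
move=> eq_s; apply/syndrome0P/eq_from_tnth => i.
have := congr1 (fun t : l.-tuple _ => tnth t i) eq_s; rewrite !tnth_mktuple sympBr => ->.
by rewrite subrr.
Qed.

Lemma in_vset C x : (x \in vset C) = (x \in C).
Proof. exact: in_set. Qed.

Lemma supported0 I : 0 \in supported p I.
Proof.
by rewrite inE; apply/forallP => i; rewrite /apart /bpart !mxE eqxx implybT.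
Qed.

Lemma supportedB I x y :
  x \in supported p I -> y \in supported p I -> x - y \in supported p I.
Proof.
rewrite !inE => /forallP x0 /forallP y0; apply/forallP => i; apply/implyP => iI.
have /andP[/eqP xa /eqP xb] := implyP (x0 i) iI.
have /andP[/eqP ya /eqP yb] := implyP (y0 i) iI.
by move: xa xb ya yb; rewrite /apart /bpart !mxE => -> -> -> ->; rewrite subrr eqxx.
Qed.

Lemma supportedP I x :
  (x \in supported p I)
    = ([set i | (apart x i != 0) || (bpart x i != 0)] \subset I).
Proof.
rewrite inE; apply/forallP/subsetP => h i.
  rewrite inE; apply: contraTT => /(implyP (h i)).
  by rewrite negb_or !negbK.
by apply/implyP; apply: contraNT => h'; apply: h; rewrite inE -negb_and.
Qed.

Lemma sweight_minP (T : {set svec}) (m : nat) :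
  reflect (forall x, x \in T -> (m <= sweight x)%N)
          (m%:Z%:E <= sweight_min T)%E.
Proof.
apply: (iffP idP) => [le_m x xT|le_m].
  by have := le_trans le_m (bigmin_le_cond _ _ xT); rewrite lee_fin lez_nat.
by apply: le_bigmin => [|x /le_m]; rewrite ?leey // lee_fin lez_nat.
Qed.

Lemma sweight_minS (T T' : {set svec}) :
  T \subset T' -> (sweight_min T' <= sweight_min T)%E.
Proof.
move=> /subsetP TT'; apply: le_bigmin => [|x /TT' xT']; first exact: bigmin_le_id.
exact: bigmin_le_cond.
Qed.

(** The chain of inclusions of [C] in [dual C] and of [dual C] in [dual D] gives one half of the
    equality for free. *)
Lemma dual_supportedE C D I : (C <= dual C)%VS -> (D <= C)%VS ->
  (vset C :&: supported p I = vset (dual D) :&: supported p I) <->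
  (forall e, e \in supported p I -> e \in dual D -> e \in C).
Proof.
move=> CC DC; split => [/setP eqI e eI eD|sub].
  by have := eqI e; rewrite !in_setI !in_vset eI eD !andbT.
apply/setP => e; rewrite !in_setI !in_vset.
have [eI|] := boolP (e \in supported p I); rewrite ?andbF // !andbT.
apply/idP/idP => [eC|]; last exact: sub.
exact: (subvP (dualS DC) _ (subvP CC _ eC)).
Qed.

(** A vector has weight at most [delta] exactly when some set of [delta] positions contains its
    support, so the weight bound is the condition of [dual_supportedE] for all such sets at once. *)
Lemma sweight_min_supported C D delta : (delta <= n)%N ->
  (C <= dual C)%VS -> (D <= C)%VS ->
  (delta.+1%:Z%:E <= sweight_min (vset (dual D) :\: vset C))%E <->
  (forall I, #|I| = delta ->
     vset C :&: supported p I = vset (dual D) :&: supported p I).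
Proof.
move=> le_delta CC DC; split.
  move=> /sweight_minP wmin I cI; apply/dual_supportedE => // e.
  rewrite supportedP => /subset_leq_card; rewrite cI => we eD.
  apply: contraTT we => eC; rewrite -ltnNge wmin //.
  by rewrite in_setD !in_vset eC.
move=> eqI; apply/sweight_minP => x; rewrite in_setD !in_vset => /andP[xC xD].
rewrite ltnNge; apply: contraNN xC => wx.
set J := [set i | (apart x i != 0) || (bpart x i != 0)] in wx.
(* The support [J] may be too small; it is padded with positions from its complement, of which there
   are enough because [delta <= n]. *)
have [I JI cI] : exists2 I : {set 'I_n}, J \subset I & #|I| = delta.
  have wx' : (#|J| <= delta)%N := wx.
  have : (delta - #|J| <= #|~: J|)%N.
    by rewrite [leqRHS]cardsCs setCK card_ord leq_sub2r.
  move=> /card_geqP[s [us szs sub]].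
  exists (J :|: [set i in s]); first exact: subsetUl.
  rewrite cardsU disjoint_setI0; last first.
    rewrite -setI_eq0; apply/eqP/setP => i; rewrite !in_setI in_set0 [i \in [set _ in s]]in_set.
    by apply/negP => /andP[iJ /sub]; rewrite in_setC iJ.
  rewrite cards0 subn0; have -> : #|[set i in s]| = size s.
    by rewrite cardsE; apply/card_uniqP.
  by rewrite szs subnKC.
have xI : x \in supported p I by rewrite supportedP.
exact: (proj1 (dual_supportedE I CC DC) (eqI I cI) x xI xD).
Qed.

End SymplecticSpace.

(** * Unitary and inverse matrices *)

Lemma expr_unitarymx (C : numClosedFieldType) m (A : 'M[C]_m) k :
  A \is unitarymx -> A ^+ k \is unitarymx.
Proof.
move=> uA; elim: k => [|k IHk].
  by apply/unitarymxP; rewrite expr0 mul1mx trmx1 map_mx1.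
rewrite exprS; exact: (mul_unitarymx uA IHk).
Qed.

(** The Hermitian square of [v] is nonzero and preserved by [U], while scaling by [c] multiplies it
    by the squared modulus of [c]. *)
Lemma unitarymx_eigenvalue (C : numClosedFieldType) m (U : 'M[C]_m)
    (v : 'cV[C]_m) (c : C) :
  U \is unitarymx -> v != 0 -> U *m v = c *: v -> `|c| = 1.
Proof.
move=> /unitarymxP /mulmx1C uU v0 Uv; apply/eqP.
rewrite -(@pexpr_eq1 _ _ 2) // normCK; apply/eqP.
set u : 'rV_m := map_mx Num.conj v^T.
have uE : map_mx Num.conj u^T = v.
  by apply/matrixP => i j; rewrite !mxE conjCK.
have u0 : u *m v != 0.
  have : dotmx u u != 0.
    by rewrite dnorm_eq0; apply: contraNneq v0 => u0; rewrite -uE u0 trmx0 map_mx0.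
  by rewrite dotmxE uE; apply: contraNneq => ->; rewrite mxE.
have : (map_mx Num.conj (U *m v)^T) *m (U *m v) = u *m v.
  by rewrite trmx_mul map_mxM -mulmxA [X in _ *m X]mulmxA uU mul1mx.
have cuE : map_mx Num.conj (c *: v)^T = c^* *: u.
  by apply/matrixP => i j; rewrite !mxE rmorphM.
rewrite Uv cuE -scalemxAl -scalemxAr scalerA mulrC => /eqP.
by rewrite -subr_eq0 -{2}[u *m v]scale1r -scalerBl scaler_eq0 (negPf u0) orbF subr_eq0 => /eqP.
Qed.

Lemma comm_invmx (F : comUnitRingType) m (A B : 'M[F]_m) :
  A *m B = B *m A -> invmx A *m B = B *m invmx A.
Proof.
(* For a singular [A] the default value of [invmx A] is [A] itself, so the claim is the
   hypothesis. *)
move=> AB; have [uA|nA] := boolP (A \in unitmx); last by rewrite /invmx (negPf nA).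
by rewrite -{1}[B](mulmxK uA) -AB !mulmxA mulVmx // mul1mx.
Qed.

(** * The root of unity [omega] and the one-qudit operators *)

Section Weyl.
Variables (R : realType) (p : nat).
Hypothesis p_prime : prime p.
Local Notation w := (omega R p).
Local Notation shiftX := (shiftX R p).
Local Notation clockZ := (clockZ R p).

Lemma omegaX k :
  w ^+ k = Complex (cos (2 * pi / p%:R *+ k)) (sin (2 * pi / p%:R *+ k)).
Proof.
elim: k => [|k IHk]; first by rewrite expr0 mulr0n cos0 sin0.
rewrite exprS IHk [_ *+ k.+1]mulrS cosD sinD; congr Complex; ring.
Qed.

Lemma omega_prim : p.-primitive_root w.
Proof.
have p0 : p%:R != 0 :> R by rewrite pnatr_eq0 -lt0n prime_gt0.
have wp : w ^+ p = 1.
  by rewrite omegaX -mulr_natr divfK // mulr_natl cos2pi sin_mulr2n sinpi mulr0 mul0rn.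
have [m m_prim m_p] := prim_order_exists (prime_gt0 p_prime) wp.
have [m1|/eqP mp] := orP (proj2 (primeP p_prime) m m_p); last by move: m_prim; rewrite mp.
have := prim_expr_order m_prim; rewrite (eqP m1) expr1 => /eqP.
rewrite eq_complex /= -mulrA mulr_natl cos_mulr2n => /andP[+ _].
rewrite subr_eq -mulr2n -subr_eq0 -mulrnBl mulrn_eq0 /= subr_eq0 => /eqP cos1.
have := cos2Dsin2 (pi / p%:R : R); rewrite cos1 => /eqP.
rewrite addrC eq_sym -subr_eq subrr eq_sym expf_eq0 /= gt_eqF // sin_gt0_pi //.
rewrite divr_gt0 ?pi_gt0 ?ltr0n ?prime_gt0 //=.
by rewrite ltr_pdivrMr ?ltr0n ?prime_gt0 // ltr_pMr ?pi_gt0 // ltr1n prime_gt1.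
Qed.

Lemma omega_norm k : `|w ^+ k| = 1.
Proof.
apply/eqP; rewrite -(@pexpr_eq1 _ _ p) ?prime_gt0 // -normrX exprAC.
by rewrite (prim_expr_order omega_prim) expr1n normr1.
Qed.

(** Exponents are natural numbers, so that they add without reduction; [weyl_mod] reconciles this
    with addition in ['F_p]. *)
Definition weyl (a b : nat) : 'M[R[i]]_p := shiftX ^+ a *m clockZ ^+ b.

Lemma shiftX_expE a i j : (shiftX ^+ a) i j = ((i : nat) == (j + a) %% p)%N%:R.
Proof.
elim: a i j => [|a IHa] i j; first by rewrite expr0 mxE addn0 modn_small.
rewrite exprSr [LHS]mxE (bigD1 (ordS j)) //= big1 ?addr0 => [|k /negPf kj].
  by rewrite IHa mxE eqxx mulr1 modnDml addSnnS.
by rewrite mxE kj mulr0.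
Qed.

Lemma clockZ_expE b i j : (clockZ ^+ b) i j = (i == j)%:R * w ^+ (i * b).
Proof.
elim: b i j => [|b IHb] i j; first by rewrite expr0 mxE muln0 mulr1.
rewrite exprSr [LHS]mxE (bigD1 j) //= big1 ?addr0 => [|k /negPf kj].
  rewrite IHb !mxE eqxx mulr1n; have [->|] := eqVneq i j; last by rewrite !mul0r.
  by rewrite !mul1r -exprD mulnSr.
by rewrite !mxE kj mulr0n mulr0.
Qed.

Lemma weylE a b i j :
  weyl a b i j = ((i : nat) == (j + a) %% p)%N%:R * w ^+ (j * b).
Proof.
rewrite mxE (bigD1 j) //= big1 ?addr0 => [|k /negPf kj].
  by rewrite shiftX_expE clockZ_expE eqxx mul1r.
by rewrite clockZ_expE kj mul0r mulr0.
Qed.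

Lemma weyl_mod a b : weyl (a %% p) (b %% p) = weyl a b.
Proof.
apply/matrixP => i j; rewrite !weylE modnDmr; congr (_ * _).
by rewrite -(prim_expr_mod omega_prim) modnMmr (prim_expr_mod omega_prim).
Qed.

(** The phase is the cost of moving Z^b past X^a'. Entrywise, only the intermediate index
    [(j + a') %% p] contributes to the product. *)
Lemma weylM a b a' b' :
  weyl a b *m weyl a' b' = w ^+ (b * a') *: weyl (a + a') (b + b').
Proof.
apply/matrixP => i j; rewrite mxE [RHS]mxE.
have ltk : ((j + a') %% p < p)%N by rewrite ltn_mod prime_gt0.
rewrite (bigD1 (Ordinal ltk)) //= big1 ?addr0 => [|k kj].
  rewrite !weylE /= eqxx mul1r modnDml -addnA [(a' + a)%N]addnC.
  rewrite -[w ^+ (_ %% p * b)](prim_expr_mod omega_prim) modnMml.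
  rewrite (prim_expr_mod omega_prim) -mulrA -exprD mulrCA; congr (_ * _).
  by rewrite -exprD; congr (_ ^+ _); rewrite mulnDr mulnDl [(b * a')%N]mulnC; ring.
rewrite [weyl a' b' _ _]weylE -val_eqE in kj *.
by rewrite (negPf kj) mul0r mulr0.
Qed.

Lemma shiftX_unitary : shiftX \is unitarymx.
Proof.
apply/unitarymxP/matrixP => i j; rewrite !mxE.
rewrite (reindex_inj (can_inj (@ord_predK p))) /= (bigD1 i) //= big1 ?addr0.
  by rewrite !mxE ord_predK eqxx mul1r conjC_nat eq_sym.
by move=> k /negPf ki; rewrite !mxE ord_predK eq_sym ki mul0r.
Qed.

Lemma clockZ_unitary : clockZ \is unitarymx.
Proof.
apply/unitarymxP/matrixP => i j; rewrite mul_diag_mx !mxE.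
have [->|_] := eqVneq i j; last by rewrite mulr0n rmorph0 mulr0.
by rewrite mulr1n -normCK omega_norm expr1n.
Qed.

Lemma weyl_unitary a b : weyl a b \is unitarymx.
Proof.
by rewrite mul_unitarymx ?expr_unitarymx ?shiftX_unitary ?clockZ_unitary.
Qed.

End Weyl.

(** * Tensor products and the multiplication rule of the operators M(x) *)

Section Pauli.
Variables (R : realType) (p n : nat).
Hypothesis p_prime : prime p.
Local Notation w := (omega R p).
Local Notation svec := (svec p n).
Local Notation pauli := (pauli R (p := p) (n := n)).
Implicit Types A B : 'I_n -> 'M[R[i]]_p.

Lemma basis_label_inj : injective (@basis_label p n).
Proof. exact: enum_val_inj. Qed.

Lemma eq_tensor A B : A =1 B -> tensor A = tensor B.
Proof.
by move=> AB; apply/matrixP => k l; rewrite !mxE; apply: eq_bigr => i _; rewrite AB.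
Qed.

(** The intermediate labels are all functions from sites to levels, so the sum over them factors
    into a product of one-site sums. *)
Lemma tensorM A B : tensor A *m tensor B = tensor (fun i => A i *m B i).
Proof.
apply/matrixP => k l; rewrite !mxE.
rewrite (reindex _ (onW_bij _ (enum_rank_bij {ffun 'I_n -> 'I_p}))) /=.
under eq_bigr => f _ do
  rewrite !mxE -big_split /= /(basis_label (enum_rank f)) enum_rankK.
rewrite -(bigA_distr_bigA
  (fun i m => A i (basis_label k i) m * B i m (basis_label l i))).
by apply: eq_bigr => i _; rewrite mxE.
Qed.

Lemma tensorZ (c : 'I_n -> R[i]) A :
  tensor (fun i => c i *: A i) = (\prod_i c i) *: tensor A.
Proof.
by apply/matrixP => k l; rewrite !mxE -big_split; apply: eq_bigr => i _; rewrite mxE.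
Qed.

Lemma tensor1 : tensor (fun=> 1%:M) = 1%:M :> 'M[R[i]]_(hdim p n).
Proof.
apply/matrixP => k l; rewrite !mxE; have [->|kl] := eqVneq k l.
  by rewrite big1 // => i _; rewrite mxE eqxx.
have [i kli] : exists i, basis_label k i != basis_label l i.
  apply/existsP; apply: contraNT kl; rewrite negb_exists => /forallP eq_kl.
  by apply/eqP/basis_label_inj/ffunP => i; apply/eqP/negPn.
by rewrite (bigD1 i) //= mxE (negPf kli) mul0r.
Qed.

Lemma tensor_unitary A :
  (forall i, A i \is unitarymx) -> tensor A \is unitarymx.
Proof.
move=> uA; apply/unitarymxP; rewrite -tensor1.
have -> : map_mx Num.conj (tensor A)^T = tensor (fun i => map_mx Num.conj (A i)^T).
  by apply/matrixP => k l; rewrite !mxE rmorph_prod; apply: eq_bigr => i _; rewrite !mxE.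
by rewrite tensorM; apply: eq_tensor => i; apply/unitarymxP.
Qed.

Lemma pauli_unitary (x : svec) : pauli x \is unitarymx.
Proof. by apply: tensor_unitary => i; apply: weyl_unitary. Qed.

Lemma val_FpD (a b : 'F_p) : (a + b)%R = ((a + b) %% p)%N :> nat.
Proof. by rewrite -[X in _ = (_ %% X)%N](Fp_cast p_prime). Qed.

Lemma pauliM (x y : svec) :
  pauli x *m pauli y
    = w ^+ (\sum_(i < n) bpart x i * apart y i)%N *: pauli (x + y).
Proof.
rewrite tensorM -prodrXr -tensorZ; apply: eq_tensor => i.
rewrite -!/(weyl _ _ _ _) weylM //; congr (_ *: _).
by rewrite -weyl_mod // -!val_FpD /apart /bpart !mxE.
Qed.

Lemma pauli_commute (x y : svec) : exists2 c : R[i],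
  pauli x *m pauli y = c *: (pauli y *m pauli x) & (c == 1) = (symp x y == 0).
Proof.
pose s (x y : svec) := (\sum_(i < n) bpart x i * apart y i)%N.
have sE u v : (s u v)%:R = \sum_(i < n) bpart u i * apart v i.
  by rewrite natr_sum; apply: eq_bigr => i _; rewrite natrM !natr_Zp.
have w0 k : w ^+ k != 0 by rewrite -normr_eq0 omega_norm // oner_eq0.
(* Both orders of the product are multiples of [pauli (x + y)], and the ratio of their phases is
   [omega] to a power congruent to [- symp x y] modulo [p]. Primitivity makes it 1 only if the form
   vanishes. *)
exists (w ^+ s x y / w ^+ s y x).
  by rewrite !pauliM addrC scalerA divfK.
rewrite -subr_eq0 -[1](divff (w0 (s y x))) -mulrBl mulf_eq0 invr_eq0 (negPf (w0 _)) orbF.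
rewrite subr_eq0 (eq_prim_root_expr (omega_prim R p_prime)).
have -> : symp x y = (s y x)%:R - (s x y)%:R.
  rewrite !sE -sumrB; apply: eq_bigr => i _; congr (_ - _); exact: mulrC.
by rewrite subr_eq0 -val_eqE /= !val_Fp_nat // eq_sym.
Qed.

End Pauli.

(** * Action of M(x) on a stabilizer code, and the correction criterion *)

Section StabilizerCode.
Variables (R : realType) (p n : nat) (C : {vspace svec p n}).
Variables (phi : 'cV[R[i]]_(hdim p n)) (eta : 'M[R[i]]_(hdim p n) -> R[i]).
Hypotheses (p_prime : prime p) (phi_eigen : common_eigen C phi eta).
Local Notation svec := (svec p n).
Local Notation pauli := (pauli R (p := p) (n := n)).
Local Notation Q := (stab_code C eta).

Lemma pauli0 : pauli 0 = 1%:M.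
Proof.
rewrite -tensor1; apply: eq_tensor => i.
by rewrite /apart /bpart !mxE !expr0 mul1mx.
Qed.

Lemma stab_group_commute (f : svec) U : f \in dual C ->
  stab_group C U -> U *m pauli f = pauli f *m U.
Proof.
move=> /dualP fC; elim=> [x xC||V W _ fV _ fW|V _ fV].
- have [c -> c1] := pauli_commute R p_prime x f.
  move: c1; rewrite symp_eq0C (fC x xC) eqxx => /eqP ->.
  by rewrite scale1r.
- by rewrite mul1mx mulmx1.
- by rewrite -mulmxA fW mulmxA fV mulmxA.
- exact: comm_invmx.
Qed.

Lemma stab_code_pauli (f : svec) psi : f \in dual C -> Q psi -> Q (pauli f *m psi).
Proof.
move=> fC Qpsi U SU.
by rewrite mulmxA (stab_group_commute fC) // -mulmxA (Qpsi U SU) scalemxAr.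
Qed.

Lemma stab_codeD psi1 psi2 : Q psi1 -> Q psi2 -> Q (psi1 + psi2).
Proof. by move=> Q1 Q2 U SU; rewrite mulmxDr (Q1 U SU) (Q2 U SU) scalerDr. Qed.

Lemma eta_pauli_norm x : x \in C -> `|eta (pauli x)| = 1.
Proof.
have [phi0 Qphi] := phi_eigen; move=> /(@stab_gen R) /Qphi.
by apply: unitarymx_eigenvalue => //; apply: pauli_unitary.
Qed.

Lemma mem_of_pauli_scalar (e : svec) :
  (forall psi, Q psi -> exists2 c : R[i], c != 0 & pauli e *m psi = c *: psi) ->
  e \in C.
Proof.
move=> eigQ; have [phi0 Qphi] := phi_eigen.
(* As [C] is its own double dual, [e] outside [C] has a witness [f] in [dual C] not orthogonal to
   it. *)
rewrite -[C]dualK; apply/negPn/negP; rewrite mem_dual negb_forall_in.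
move=> /exists_inP[f fC ef].
have [c ecf c1] := pauli_commute R p_prime e f.
have Qfphi := stab_code_pauli fC Qphi.
have [l l0 eigl] := eigQ _ Qphi.
have [m _ eigm] := eigQ _ (stab_codeD Qphi Qfphi).
have fphi0 : pauli f *m phi != 0.
  apply: contraNneq phi0 => f0.
  by rewrite -(mulKmx (unitarymx_unit (pauli_unitary R p_prime f)) phi) f0 mulmx0.
have eigf : pauli e *m (pauli f *m phi) = (c * l) *: (pauli f *m phi).
  by rewrite mulmxA ecf -scalemxAl -mulmxA eigl -scalemxAr scalerA.
have c_neq1 : 1 - c != 0 by rewrite subr_eq0 eq_sym c1.
move: phi0 fphi0 eigl eigf eigm; rewrite mulmxDr.
move: phi (pauli f *m phi) => a b a0 b0 ea eb; rewrite ea eb scalerDr => eab.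
(* Here M(e) has eigenvalues [l] on [a], [c * l] on [b] and [m] on [a + b]. *)
have dep : (l - m) *: a = (m - c * l) *: b.
  have la : l *: a = m *: a + m *: b - (c * l) *: b by rewrite -eab addrK.
  by rewrite !scalerBl la addrAC [m *: a + _]addrC addrK.
(* Applying M(e) to [dep] and subtracting [c * l] times [dep] eliminates [b]. This forces [l = m],
   and [dep] then makes [l * (1 - c)] kill the nonzero [b]. *)
have := congr1 (mulmx (pauli e)) dep.
rewrite -!scalemxAr ea eb !scalerA => dep'.
have : ((l - m) * (l * (1 - c))) *: a = 0.
  have -> : (l - m) * (l * (1 - c)) = (l - m) * l - (c * l) * (l - m) by ring.
  by rewrite scalerBl dep' -[(_ * (l - m)) *: a]scalerA dep scalerA [(c * l) * _]mulrC subrr.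
move/eqP; rewrite scaler_eq0 (negPf a0) orbF !mulf_eq0 (negPf l0) (negPf c_neq1) !orbF.
rewrite subr_eq0 => /eqP lm; move: dep; rewrite -lm subrr scale0r => /esym /eqP.
by rewrite scaler_eq0 (negPf b0) orbF -{1}[l]mul1r -mulrBl mulf_eq0 (negPf c_neq1) (negPf l0).
Qed.

Lemma correctsP (I : {set 'I_n}) l (xs : l.-tuple svec) :
  corrects Q I xs <->
  (forall e, e \in supported p I -> e \in dual <<xs>> -> e \in C).
Proof.
split=> [corr e eI exs|sub s].
  have [U uU Ue] := corr [tuple 0 | _ < l].
  apply: mem_of_pauli_scalar => psi Qpsi.
  (* The zero error has the same syndrome as [e], so one [U] sends both [psi] and M(e) [psi] to
     multiples of [psi]; injectivity of [U] makes M(e) [psi] a multiple of [psi]. *)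
  have s0 := elimT (syndrome0P xs 0) (mem0v _).
  have [c c1] := Ue 0 (supported0 _ _) s0 psi Qpsi.
  rewrite pauli0 mul1mx => Upsi.
  have [c' c'1 Uepsi] := Ue e eI (elimT (syndrome0P xs e) exs) psi Qpsi.
  have c0 : c != 0 by rewrite -normr_eq0 c1 oner_eq0.
  exists (c' / c).
    by rewrite mulf_neq0 ?invr_eq0 // -normr_eq0 c'1 oner_eq0.
  have uU' := unitarymx_unit uU.
  apply: (can_inj (mulKmx uU')); rewrite Uepsi -scalemxAr Upsi scalerA divfK //.
have [e0 /andP[e0I /eqP e0s]|none] :=
    pickP [pred e | (e \in supported p I) && (syndrome xs e == s)]; last first.
  (* No error on [I] produces the syndrome [s], so any unitary will do. *)
  exists 1%:M => [|e eI es]; first by apply/unitarymxP; rewrite mul1mx trmx1 map_mx1.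
  by have := none e; rewrite /= eI es eqxx.
exists (map_mx Num.conj (pauli e0)^T); first by rewrite trmxC_unitary pauli_unitary.
move=> e eI es psi Qpsi.
have dC : e - e0 \in C.
  by apply: sub; [exact: supportedB|apply: syndromeB; rewrite es].
have [k ek] : exists k, pauli e0 *m pauli (e - e0) = omega R p ^+ k *: pauli e.
  by rewrite pauliM // [e0 + _]addrC subrK; eexists.
have k0 : omega R p ^+ k != 0 by rewrite -normr_eq0 omega_norm // oner_eq0.
(* The inverse power undoes the phase of [pauliM] in splitting M(e) as M(e0) M(e - e0); the second
   factor acts on codewords by [eta]. *)
exists ((omega R p ^+ k)^-1 * eta (pauli (e - e0))).
  by rewrite normrM normfV omega_norm // eta_pauli_norm // invr1 mulr1.
have -> : pauli e = (omega R p ^+ k)^-1 *: (pauli e0 *m pauli (e - e0)).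
  by rewrite ek scalerA mulVf // scale1r.
rewrite -scalemxAl -mulmxA (Qpsi _ (stab_gen R dC)) -!scalemxAr scalerA mulmxA.
by rewrite (mulmx1C (unitarymxP (pauli_unitary R p_prime e0))) mul1mx.
Qed.

Lemma corrects_dualE (I : {set 'I_n}) l (xs : l.-tuple svec) :
  (C <= dual C)%VS -> {subset xs <= C} ->
  corrects Q I xs <->
  vset C :&: supported p I = vset (dual <<xs>>) :&: supported p I.
Proof.
move=> CC /span_subvP xsC.
by rewrite correctsP dual_supportedE.
Qed.

End StabilizerCode.

(** * Transfer principles for minima and maxima *)

Lemma is_min_cofinal (P P' : nat -> Prop) :
  (forall k, P' k -> P k) -> (forall k, P k -> exists2 d, P' d & (d <= k)%N) ->
  forall m, is_min P m <-> is_min P' m.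
Proof.
move=> P'P PP' m; split=> -[Pm minm]; split.
- have [d P'd le_dm] := PP' m Pm.
  by have /eqP <- : d == m by rewrite eqn_leq le_dm minm //; apply: P'P.
- by move=> k /P'P; apply: minm.
- exact: P'P.
- by move=> k /PP'[d /minm md /(leq_trans md)].
Qed.

(** Subtraction from [N] reverses the order; the bounds [d <= N] make the truncated subtraction an
    involution. *)
Lemma is_min_sub_max (P P' : nat -> Prop) N :
  (forall d, P d -> (d <= N)%N /\ P' (N - d)%N) ->
  (forall d, P' d -> (d <= N)%N /\ P (N - d)%N) ->
  forall m, is_min P m <-> exists2 M, is_max P' M & m = (N - M)%N.
Proof.
move=> PP' P'P m; split=> [[Pm minm]|[M [P'M maxM] ->]].
  have [mN P'm] := PP' m Pm.
  exists (N - m)%N; last by rewrite subKn.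
  split=> // k /P'P[kN /minm le_m].
  by rewrite -(subKn kN) leq_sub2l.
have [MN PM] := P'P M P'M; split=> // k /PP'[kN /maxM le_M].
by rewrite -(subKn kN) leq_sub2l.
Qed.

(** * The two minimum formulas and the bound by the minimum distance *)

Theorem theorem8 (R : realType) (p n : nat) (C : {vspace svec p n})
    (phi : 'cV[R[i]]_(hdim p n)) (eta : 'M[R[i]]_(hdim p n) -> R[i])
    (p_prime : prime p) (n_gt0 : (0 < n)%N) (C_isotropic : (C <= dual C)%VS)
    (phi_eigen : common_eigen C phi eta) :
  [/\ (* (1) *)
      forall I : {set 'I_n},
        (forall (l : nat) (xs : l.-tuple (svec p n)),
           {subset xs <= C} ->
           corrects (stab_code C eta) I xs ->
           vset C :&: supported p I = vset (dual <<xs>>) :&: supported p I)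
        /\
        (forall m : nat,
           is_min (fun l => exists xs : l.-tuple (svec p n),
                     {subset xs <= C} /\ corrects (stab_code C eta) I xs) m
           <->
           is_min (fun d => exists D : {vspace svec p n},
                     [/\ (D <= C)%VS,
                         vset C :&: supported p I
                           = vset (dual D) :&: supported p I
                       & \dim D = d]) m),
      (* (2) *)
      forall delta : nat, (delta <= n)%N -> forall m : nat,
        (is_min (fun k => exists X : {set svec p n},
                   [/\ {subset X <= C},
                       forall I : {set 'I_n}, #|I| = delta ->
                         corrects (stab_code C eta) I (enum_tuple X)
                     & #|X| = k]) m
         <->
         is_min (fun d => exists D : {vspace svec p n},
                   [/\ (D <= C)%VS,
                       (delta.+1%:Z%:E
                          <= sweight_min (vset (dual D) :\: vset C))%E
                     & \dim D = d]) m)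
        /\
        (is_min (fun d => exists D : {vspace svec p n},
                   [/\ (D <= C)%VS,
                       (delta.+1%:Z%:E
                          <= sweight_min (vset (dual D) :\: vset C))%E
                     & \dim D = d]) m
         <->
         exists2 M : nat,
           is_max (fun d => exists D : {vspace svec p n},
                     [/\ (dual C <= dual D)%VS,
                         (delta.+1%:Z%:E
                            <= sweight_min (vset (dual D) :\: vset C))%E
                       & \dim (dual D) = d]) M
           & m = (2 * n - M)%N)
    & forall D : {vspace svec p n}, (D <= C)%VS ->
        (min_distance D <= sweight_min (vset (dual D) :\: vset C))%E].
Proof.
have memP l (xs : l.-tuple (svec p n)) : {subset xs <= C} <-> (<<xs>> <= C)%VS.
  by split=> /span_subvP.
split=> [I|delta le_delta m|D DC]; last first.
(* Removing the larger space [C] leaves a smaller set, whose minimum weight can only be larger. *)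
- apply: sweight_minS; apply/subsetP => x; rewrite !in_setD !in_vset.
  by case/andP=> xC ->; rewrite andbT; apply: contraNN xC; apply: (subvP DC).
- split.
    apply: is_min_cofinal => [_ [D [DC wD <-]]|_ [X [XC corr <-]]].
      (* A basis is free, hence without repetition, so as a set it has exactly [\dim D] elements. *)
      exists [set x in vbasis D]; split; last 1 first.
      + rewrite cardsE (card_uniqP _) ?size_tuple //.
        exact: free_uniq (basis_free (vbasisP D)).
      + by move=> x; rewrite inE => /vbasis_mem /(subvP DC).
      move=> I cI.
      have spanE : <<enum_tuple [set x in vbasis D]>>%VS = D.
        rewrite -[RHS](span_basis (vbasisP D)); apply: eq_span => x.
        by rewrite mem_enum inE.
      apply/(corrects_dualE p_prime phi_eigen) => //.
        by apply/memP; rewrite spanE.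
      by rewrite spanE; apply: (proj1 (sweight_min_supported le_delta C_isotropic DC) wD).
    have XC' : {subset enum_tuple X <= C} by move=> x; rewrite mem_enum => /XC.
    have DC : (<<enum_tuple X>> <= C)%VS by apply/memP.
    (* Dependent observables are redundant: correction depends only on the span, whose dimension is
       at most the size of [X]. *)
    exists (\dim <<enum_tuple X>>); last first.
      by rewrite (leq_trans (dim_span _)) // size_tuple.
    exists <<enum_tuple X>>%VS; split=> //.
    apply/sweight_min_supported => // I cI.
    exact: (proj1 (corrects_dualE p_prime phi_eigen I C_isotropic XC') (corr I cI)).
  have dimE (D : {vspace svec p n}) : (2 * n = \dim (dual D) + \dim D)%N.
    by rewrite dim_dual addnn mul2n.
  have dim2 (D : {vspace svec p n}) : \dim (dual D) = (2 * n - \dim D)%N.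
    by rewrite (dimE D) addnK.
  have dimle (D : {vspace svec p n}) : (\dim D <= 2 * n)%N.
    by rewrite (dimE D) leq_addl.
  (* The same [D] serves on both sides, since [\dim (dual D)] is [2 * n - \dim D]; double duality
     turns the reversed inclusion back. *)
  apply: is_min_sub_max => [_ [D [DC wD <-]]|_ [D [DC wD <-]]].
    by split=> //; exists D; split; rewrite ?dualS.
  split=> //; exists D; split=> //; last by rewrite dim2 subKn.
  by rewrite -[D]dualK -[C]dualK dualS.
split=> [l xs xsC|]; first exact: (proj1 (corrects_dualE p_prime phi_eigen I C_isotropic xsC)).
apply: is_min_cofinal => [_ [D [DC eqD <-]]|l [xs [xsC corr]]].
  exists (vbasis D); have spanE := span_basis (vbasisP D).
  have sub : {subset vbasis D <= C} by apply/memP; rewrite spanE.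
  by split=> //; apply/(corrects_dualE p_prime phi_eigen) => //; rewrite spanE.
exists (\dim <<xs>>); last by rewrite -[leqRHS](size_tuple xs) dim_span.
exists <<xs>>%VS; split=> //; first exact/memP.
by apply/(corrects_dualE p_prime phi_eigen).
Qed.
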